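(* There is a $1$-dimensional, equivalence-free $\mathrm{FO}$-interpretation $\Theta$ and, for every $k\in\mathbb N$, a pair of $\{R,\preceq\}$-structures $(\mathfrak A_k,\mathfrak B_k)$ with $R$ ternary and $\preceq$ binary such that: (a) $\preceq$ is a total preorder on $\mathfrak A_k$ and on $\mathfrak B_k$; (b) $\mathfrak A_k$ and $\mathfrak B_k$ are asymmetric; (c) $\mathfrak A_k\equiv_{C^k}\mathfrak B_k$; (d) $\mathfrak A_k\not\cong\mathfrak B_k$; and (e) $\Theta(\mathfrak A_k)$ and $\Theta(\mathfrak B_k)$ are non-isomorphic CFI graphs over the same ordered base graph.
   Context: A structure is asymmetric if its only automorphism is the identity. $\equiv_{C^k}$ denotes indistinguishability in $k$-variable first-order logic with counting quantifiers. An $\mathrm{FO}$-interpretation of dimension $1$ that is equivalence-free consists of first-order formulas $\varphi_{\mathrm{dom}}(x)$ and $\varphi_S(x_1,\dots,x_{\mathrm{ar}(S)})$ for each target relation symbol $S$; its image on $\mathfrak A$ has universe $\{v:\mathfrak A\models\varphi_{\mathrm{dom}}(v)\}$ and relations defined by the $\varphi_S$ (no quotient). CFI graphs (in the variant with one edge-vertex pair per base edge): for an ordered base graph (connected simple graph with a total order) $H=(V^H,E^H)$ and $f:E^H\to\mathbb F_2$, take for each base edge $e$ an edge-vertex pair $\{e_0,e_1\}$ and for each base vertex of degree $d$ gadget vertices $\bar b\in\mathbb F_2^d$ (indexed by incident edges) with $\sum b=0$, with adjacency as obtained from the standard CFI construction (two edge-vertex pairs per edge joined by edges $a_{ik}a'_{j\ell}$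 with $k+\ell=f(e)$, gadget vertex $\bar b$ adjacent to $a_{ij}$ iff $b_i=j$) by contracting the matching between the two pairs of each base edge; vertices are colored (via a total preorder) by their origin. $\mathrm{CFI}(H,f)\cong\mathrm{CFI}(H,g)$ iff $\sum f=\sum g$. *)

(* Defs.v *)
From HB Require Import structures.
From mathcomp Require Import all_boot all_order all_algebra.

Set Implicit Arguments.
Unset Strict Implicit.
Unset Printing Implicit Defensive.

Import Order.TTheory GRing.Theory.

Record signature := Signature { symbol :> Type; arity : symbol -> nat }.

Record structure (sg : signature) := Structure {
  univ :> finType;
  holds : forall s : sg, (arity s).-tuple univ -> bool }.
Arguments holds {sg} A s t : rename.

Definition is_iso (sg : signature) (A B : structure sg) (h : A -> B) : Prop :=
  bijective h /\
  forall (s : sg) (t : (arity s).-tuple A),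
    holds B s (map_tuple h t) = holds A s t.

Definition isomorphic (sg : signature) (A B : structure sg) : Prop :=
  exists h : A -> B, is_iso h.

Definition asymmetric (sg : signature) (A : structure sg) : Prop :=
  forall h : A -> A, is_iso h -> h =1 id.

(* [FExGe m x p] is the counting quantifier "at least m elements x satisfy p".*)
Inductive formula (sg : signature) : Type :=
| FEq of nat & nat
| FRel (s : sg) of (arity s).-tuple nat
| FNot of formula sg
| FAnd of formula sg & formula sg
| FEx of nat & formula sg
| FExGe of nat & nat & formula sg.

Fixpoint first_order (sg : signature) (p : formula sg) : bool :=
  match p with
  | FEq _ _ | FRel _ _ => true
  | FNot q => first_order q
  | FAnd q r => first_order q && first_order r
  | FEx _ q => first_order q
  | FExGe _ _ _ => false
  end.

Fixpoint vars (sg : signature) (p : formula sg) : seq nat :=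
  match p with
  | FEq x y => [:: x; y]
  | FRel _ xs => xs
  | FNot q => vars q
  | FAnd q r => vars q ++ vars r
  | FEx x q | FExGe _ x q => x :: vars q
  end.

Fixpoint free_vars (sg : signature) (p : formula sg) : seq nat :=
  match p with
  | FEq x y => [:: x; y]
  | FRel _ xs => xs
  | FNot q => free_vars q
  | FAnd q r => free_vars q ++ free_vars r
  | FEx x q | FExGe _ x q => [seq y <- free_vars q | y != x]
  end.

(* Assignments are partial, so that sentences can be evaluated under the empty
   assignment (also on an empty universe).  An atom with an unassigned variable
   is false; this never matters when all free variables are assigned. *)
Definition update (A : Type) (nu : nat -> option A) (x : nat) (a : A) :
    nat -> option A :=
  fun y => if y == x then Some a else nu y.

Fixpoint eval (sg : signature) (A : structure sg) (nu : nat -> option A)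
    (p : formula sg) : bool :=
  match p with
  | FEq x y => [exists a : A, (nu x == Some a) && (nu y == Some a)]
  | FRel s xs =>
      [exists t : (arity s).-tuple A,
         (map nu xs == map Some t) && holds A s t]
  | FNot q => ~~ eval nu q
  | FAnd q r => eval nu q && eval nu r
  | FEx x q => [exists a : A, eval (update nu x a) q]
  | FExGe m x q => m <= #|[pred a : A | eval (update nu x a) q]|
  end.

(* [sat A t p] is "A |= p(t)", the variables 0, 1, ... being assigned the
   entries of t in turn. *)
Definition sat (sg : signature) (A : structure sg) (t : seq A)
    (p : formula sg) : bool := eval (onth t) p.

Definition Ck_sentence (sg : signature) (k : nat) (p : formula sg) : bool :=
  all (fun x => x < k) (vars p) && nilp (free_vars p).

Definition Ck_equiv (sg : signature) (k : nat) (A B : structure sg) : Prop :=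
  forall p : formula sg,
    Ck_sentence k p -> sat (A := A) [::] p = sat (A := B) [::] p.

(* One-dimensional, equivalence-free. *)
Record FO_interpretation (sg tau : signature) := FOInterpretation {
  dom_formula : formula sg;
  rel_formula : tau -> formula sg;
  dom_first_order : first_order dom_formula;
  dom_free_vars : all (fun x => x < 1) (free_vars dom_formula);
  rel_first_order : forall s : tau, first_order (rel_formula s);
  rel_free_vars : forall s : tau,
    all (fun x => x < arity s) (free_vars (rel_formula s)) }.

Definition image_structure (sg tau : signature) (T : FO_interpretation sg tau)
    (A : structure sg) : structure tau :=
  @Structure tau {v : A | sat [:: v] (dom_formula T)}
    (fun s t => sat (map val t) (rel_formula T s)).

Inductive R_preceq_symbol := symR | symPreceq.

Definition sig_R_preceq : signature :=
  @Signature R_preceq_symbol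
    (fun s => match s with symR => 3 | symPreceq => 2 end).

Definition preceq (A : structure sig_R_preceq) : rel A :=
  fun x y => holds A symPreceq [tuple x; y].
Arguments preceq : clear implicits.

Definition total_preorder (T : Type) (r : rel T) : Prop :=
  [/\ reflexive r, transitive r & total r].

Record ordered_base_graph := OrderedBaseGraph {
  base_disp : Order.disp_t;
  base_vertex :> finOrderType base_disp;
  base_adj : rel base_vertex;
  base_adj_sym : symmetric base_adj;
  base_adj_irr : irreflexive base_adj;
  base_nonempty : 0 < #|base_vertex|;
  base_connected : forall u v : base_vertex, connect base_adj u v }.

Section CFI.
Variable H : ordered_base_graph.
Local Open Scope ring_scope.

(* An undirected base edge is stored as the pair (smaller end, larger end). *)
Definition base_edge :=
  {e : H * H | base_adj e.1 e.2 && (e.1 < e.2)%O}.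

Definition incident (u : H) (e : base_edge) : bool :=
  (u == (val e).1) || (u == (val e).2).

(* A vector indexed by the edges incident with u is extended by 0 to all base
   edges. *)
Definition gadget_vertex :=
  {w : H * {ffun base_edge -> 'F_2} |
    [forall e, ~~ incident w.1 e ==> (w.2 e == 0)]
    && (\sum_(e | incident w.1 e) w.2 e == 0)}.

Definition outer_vertex := {a : H * base_edge * 'F_2 | incident a.1.1 a.1.2}.

(* The standard construction: [inl (u, b)] is the gadget vertex b of u, and
   [inr (u, e, j)] is the vertex j of the edge-vertex pair of u for e. *)
Definition std_vertex : finType := (gadget_vertex + outer_vertex)%type.

Definition std_adj (f : base_edge -> 'F_2) : rel std_vertex :=
  fun x y =>
  match x, y with
  | inl w, inr a | inr a, inl w =>
      let: (u, e, j) := val a in (u == (val w).1) && ((val w).2 e == j)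
  | inr a, inr a' =>
      let: (u, e, k) := val a in
      let: (u', e', l) := val a' in
      [&& u != u', e == e' & k + l == f e]
  | inl _, inl _ => false
  end.

(* The variant with one pair per base edge: [inr (e, j)] is e_j. *)
Definition CFI_vertex : finType := (gadget_vertex + base_edge * 'F_2)%type.

(* The contraction map: its fibres are the edges of the matching between the
   two pairs of a base edge, and the single gadget vertices (see
   [CFI_contract_fibre] and [CFI_contract_surj]).  The name e_j is fixed by the
   smaller end of e. *)
Definition CFI_contract (f : base_edge -> 'F_2) (x : std_vertex) : CFI_vertex :=
  match x with
  | inl w => inl w
  | inr a =>
      let: (u, e, j) := val a in
      inr (e, if u == (val e).1 then j else j + f e)
  end.

Definition CFI_adj (f : base_edge -> 'F_2) : rel CFI_vertex :=
  fun p q =>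
  (p != q) &&
  [exists x, exists y,
     [&& CFI_contract f x == p, CFI_contract f y == q & std_adj f x y]].

(* Origins are ordered: base vertices in their order, followed by the base
   edges in lexicographic order. *)
Definition CFI_le : rel CFI_vertex :=
  fun p q =>
  match p, q with
  | inl w, inl w' => ((val w).1 <= (val w').1)%O
  | inl _, inr _ => true
  | inr _, inl _ => false
  | inr (e, _), inr (e', _) =>
      ((val e).1 < (val e').1)%O
      || ((val e).1 == (val e').1) && ((val e).2 <= (val e').2)%O
  end.

End CFI.

Inductive graph_symbol := symE | symLe.

Definition sig_graph : signature :=
  @Signature graph_symbol (fun _ => 2).

Definition CFI (H : ordered_base_graph) (f : base_edge H -> 'F_2) :
    structure sig_graph :=
  @Structure sig_graph (CFI_vertex H)
    (fun s t => match s with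
                | symE => CFI_adj f (tnth t ord0) (tnth t ord_max)
                | symLe => CFI_le (tnth t ord0) (tnth t ord_max)
                end).

Section CFIFacts.
Variables (H : ordered_base_graph) (f : base_edge H -> 'F_2).
Local Open Scope ring_scope.

Lemma F2_addrr (x : 'F_2) : x + x = 0.
Proof. by case: x => [[|[|x]] hx]; apply/val_inj. Qed.

Lemma base_edge_neq (e : base_edge H) :
  (((val e).1 == (val e).2) = false) * (((val e).2 == (val e).1) = false).
Proof. by case/andP: (valP e) => _ lt; rewrite lt_eqF // gt_eqF. Qed.

Lemma CFI_contract_fibre (x y : std_vertex H) :
  CFI_contract f x = CFI_contract f y <->
  x = y \/
  exists a a' : outer_vertex H, [/\ x = inr a, y = inr a' & std_adj f x y].
Proof.
split; last first.
  case=> [->//|[a [a' [-> ->]]]].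
  case: a => [[[u e] j] ha]; case: a' => [[[u' e'] l] ha'] /=.
  case/and3P => neq /eqP ee' /eqP fe; subst e'; congr (inr (_, _)).
  move: (ha) (ha') neq; rewrite /incident /=.
  case/orP=> /eqP-> /orP[]/eqP->; rewrite ?eqxx ?base_edge_neq // => _.
  - by rewrite -fe addrCA F2_addrr addr0.
  - by rewrite -fe addrA F2_addrr add0r.
case: x y => [w|[[[u e] j] ha]] [w'|[[[u' e'] l] ha']] //=.
  by case=> ->; left.
case=> ee'; subst e'.
have /orP[/eqP/= hu|/eqP/= hu] := ha; have /orP[/eqP/= hu'|/eqP/= hu'] := ha';
  subst u u'; rewrite ?eqxx ?base_edge_neq => hj.
- by left; congr inr; apply/val_inj; rewrite /= hj.
- right; do 2!eexists; split=> //=.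
  by rewrite hj addrAC F2_addrr add0r eqxx.
- right; do 2!eexists; split=> //=.
  by rewrite -hj addrA F2_addrr add0r eqxx.
- by left; congr inr; apply/val_inj; rewrite /= (addIr _ hj).
Qed.

Lemma CFI_contract_surj (p : CFI_vertex H) : exists x, CFI_contract f x = p.
Proof.
case: p => [w|[e j]]; first by exists (inl w).
have inc : incident (val e).1 e by rewrite /incident eqxx.
by exists (inr (exist _ ((val e).1, e, j) inc)); rewrite /= eqxx.
Qed.

End CFIFacts.

(* Main.v *)
(** The affine plane over ['F_p] ([p] an odd prime larger than [k]) is read as a
    system of parity constraints over ['F_2]: the variables are the points and
    every line asks for the parity of its points.  Replacing each variable by a
    pair of nodes and each constraint by a CFI gadget gives structures whose
    automorphisms are the solutions of the homogeneous system, and this system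
    has only the zero solution.  A line is not covered by fewer than [p] other
    lines and points, so in the [k]-pebble game Duplicator can always move a
    violated constraint away from the pebbles.  The points are the edges of
    [K_(p,p)], whose vertices are the vertical and the horizontal lines; the
    gadgets of these lines form a CFI graph, in which the sum of the twists is
    an isomorphism invariant. *)

Require Import Defs.
From mathcomp Require Import all_boot all_order all_algebra.

Set Implicit Arguments.
Unset Strict Implicit.
Unset Printing Implicit Defensive.

Import Order.TTheory GRing.Theory.

Local Open Scope ring_scope.

(** * Isomorphisms and evaluation *)

Lemma isomorphic_sym (sg : signature) (A B : structure sg) :
  isomorphic A B -> isomorphic B A.
Proof.
case=> h [[h' hK h'K] hol]; exists h'; split; first by exists h.
move=> s t; rewrite -hol; congr (holds B s _).
by apply: eq_from_tnth => i; rewrite !tnth_map h'K.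
Qed.

Lemma isomorphic_trans (sg : signature) (A B D : structure sg) :
  isomorphic A B -> isomorphic B D -> isomorphic A D.
Proof.
case=> h [bh hol] [h2 [bh2 hol2]]; exists (h2 \o h); split.
  exact: bij_comp.
move=> s t; rewrite -hol -hol2; congr (holds D s _).
by apply: eq_from_tnth => i; rewrite !tnth_map.
Qed.

Lemma eval_FEq (sg : signature) (A : structure sg) (nu : nat -> option A) i j :
  eval nu (FEq sg i j) = (nu i == nu j) && isSome (nu i).
Proof.
apply/existsP/andP => /= [[a /andP[/eqP-> /eqP->]]//|[/eqP <-]].
by case: (nu i) => // a _; exists a; rewrite eqxx.
Qed.

Lemma eval_FRel (sg : signature) (A : structure sg) (nu : nat -> option A)
    (s : sg) (xs : (arity s).-tuple nat) (z : (arity s).-tuple A) :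
  map nu xs = map Some z -> eval nu (FRel xs) = holds A s z.
Proof.
move=> nuz; apply/existsP/idP => /= [[z' /andP[/eqP]]|hz].
  rewrite nuz => /(inj_map (@Some_inj _)) zz'.
  by rewrite (val_inj zz' : z = z').
by exists z; rewrite nuz eqxx.
Qed.

(* An element and its image have equally many elements strictly below them. *)
Lemma preorder_aut_class (T : finType) (le : rel T) (h : T -> T) :
  total_preorder le -> bijective h ->
  (forall x y, le (h x) (h y) = le x y) ->
  forall x, le x (h x) && le (h x) x.
Proof.
move=> [lexx le_trans le_total] bij_h hle x.
pose below y := [set z | ~~ le y z].
have card_h : #|below (h x)| = #|below x|.
  rewrite -(on_card_preimset (onW_bij _ bij_h) : #|h @^-1: below (h x)| = _).
  by apply: eq_card => z; rewrite !inE hle.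
(* If [y] is strictly below [z], then [below y] is contained in [below z], and [y] itself lies only
   in the latter. *)
have below_lt y z : ~~ le z y -> (#|below y| < #|below z|)%N.
  move=> nzy; apply: proper_card; apply/properP; split.
    apply/subsetP => u; rewrite !inE; apply: contra => zu.
    by have:= le_total z y; rewrite (negPf nzy) /= => /le_trans; apply.
  by exists y; rewrite !inE // negbK lexx.
by apply/andP; split; apply: contraT => /below_lt; rewrite card_h ltnn.
Qed.

(** * Gadget systems of parity constraints *)

Lemma F2_addrK (x y : 'F_2) : x + y + y = x.
Proof. by rewrite -addrA F2_addrr addr0. Qed.

Lemma F2_neq0 (x : 'F_2) : x != 0 -> x = 1.
Proof. by case: x => [[|[|x]] hx] // _; apply/val_inj. Qed.

Lemma F2_eq_add (x y z : 'F_2) : (x == y + z) = (y == x + z).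
Proof. by apply/eqP/eqP => ->; rewrite F2_addrK. Qed.

Section System.
Variables (C V : finType) (inc : C -> V -> bool).

(* Every constraint [c] asks that the variables [v] with [inc c v] have a
   prescribed parity.  The types generalise [gadget_vertex] and [CFI_vertex],
   which are the instance [inc := incident]. *)
Definition gadget :=
  {w : C * {ffun V -> 'F_2} |
    [forall v, ~~ inc w.1 v ==> (w.2 v == 0)]
    && (\sum_(v | inc w.1 v) w.2 v == 0)}.

Definition node : finType := (gadget + V * 'F_2)%type.

(** The twist [t c v] swaps, when it is 1, the two nodes of [v] as seen from the gadgets of [c]. Up
    to isomorphism it only matters through its sum over the variables of [c], the parity asked by
    [c]. *)
Definition node_adj (t : C -> V -> 'F_2) : rel node :=
  fun p q =>
  match p, q with
  | inl w, inr (v, j) | inr (v, j), inl w =>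
      inc (val w).1 v && ((val w).2 v + t (val w).1 v == j)
  | _, _ => false
  end.

Definition node_le (leC : rel C) (leV : rel V) : rel node :=
  fun p q =>
  match p, q with
  | inl w, inl w' => leC (val w).1 (val w').1
  | inl _, inr _ => true
  | inr _, inl _ => false
  | inr (v, _), inr (v', _) => leV v v'
  end.

Lemma gadget_sum (w : gadget) : \sum_(v | inc (val w).1 v) (val w).2 v = 0.
Proof. by case/andP: (valP w) => _ /eqP. Qed.

Lemma gadget_eq (w w' : gadget) :
  (val w).1 = (val w').1 ->
  (forall v, inc (val w).1 v -> (val w).2 v = (val w').2 v) -> w = w'.
Proof.
case: w w' => [[c w] hw] [[c' w'] hw'] /= cc'; subst c' => eqw.
apply: val_inj => /=; congr (_, _); apply/ffunP => v.
case: (boolP (inc c v)) => [/eqw//|ncv].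
case/andP: hw => /forallP/(_ v)/=; rewrite ncv /= => /eqP-> _.
by case/andP: hw' => /forallP/(_ v)/=; rewrite ncv /= => /eqP-> _.
Qed.

Lemma gadget_exists (c : C) (y : V -> 'F_2) :
  \sum_(v | inc c v) y v = 0 ->
  exists w : gadget, (val w).1 = c /\ forall v, inc c v -> (val w).2 v = y v.
Proof.
move=> y0; pose b := [ffun v => if inc c v then y v else 0].
have hb : [forall v, ~~ inc (c, b).1 v ==> ((c, b).2 v == 0)]
    && (\sum_(v | inc (c, b).1 v) (c, b).2 v == 0).
  apply/andP; split; first by apply/forallP => v /=; rewrite ffunE; case: ifP.
  by apply/eqP; rewrite -[RHS]y0; apply: eq_bigr => v /= cv; rewrite ffunE cv.
by exists (exist _ (c, b) hb); split=> // v /= cv; rewrite ffunE cv.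
Qed.

Lemma node_le_total (leC : rel C) (leV : rel V) :
  total_preorder leC -> total_preorder leV -> total_preorder (node_le leC leV).
Proof.
case=> Cr Ct Co [Vr Vt Vo]; split.
- by case=> [w|[v j]] /=.
- by case=> [w|[v j]] [w'|[v' j']] [w''|[v'' j'']] //=; [apply: Ct|apply: Vt].
- by case=> [w|[v j]] [w'|[v' j']] //=.
Qed.

Lemma node_le_equiv (leC : rel C) (leV : rel V) (p q : node) :
  antisymmetric leC -> antisymmetric leV ->
  node_le leC leV p q && node_le leC leV q p ->
  match p, q with
  | inl w, inl w' => (val w).1 = (val w').1
  | inr (v, _), inr (v', _) => v = v'
  | _, _ => False
  end.
Proof.
move=> aC aV; case: p q => [w|[v j]] [w'|[v' j']] //=; first exact: aC.
  exact: aV.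
Qed.

(* [linked t t' x p q]: flipping the variables by [x] carries the node [p] of
   the system with twist [t] to the node [q] of the system with twist [t']. *)
Definition linked (t t' : C -> V -> 'F_2) (x : V -> 'F_2) (p q : node) : bool :=
  match p, q with
  | inl w, inl w' =>
      ((val w').1 == (val w).1) &&
      [forall v, inc (val w).1 v ==>
        ((val w').2 v ==
           (val w).2 v + (x v + t (val w).1 v + t' (val w).1 v))]
  | inr (v, j), inr (v', j') => (v' == v) && (j' == j + x v)
  | _, _ => false
  end.

Definition touches (p : node) (v : V) : bool :=
  match p with
  | inl w => inc (val w).1 v
  | inr (v', _) => v == v'
  end.

(** * Flips of variables as partial isomorphisms *)

Section Linked.
Variables (t t' : C -> V -> 'F_2) (x : V -> 'F_2).

(** Both gadget vectors have even parity, hence so has the shift between them. A linked gadget thus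
    certifies that [x] meets its constraint. *)
Lemma linked_sum (w : gadget) (q : node) :
  linked t t' x (inl w) q ->
  \sum_(v | inc (val w).1 v)
     (x v + t (val w).1 v + t' (val w).1 v) = 0.
Proof.
case: q => // w' /andP[/eqP cc' /forallP eqw].
have := gadget_sum w'; rewrite cc'.
rewrite (eq_bigr _ (fun v cv => eqP (implyP (eqw v) cv))) big_split /=.
by rewrite gadget_sum add0r.
Qed.

(** Being linked reads the flip only at touched variables, so changes elsewhere leave a pebbled pair
    linked. *)
Lemma linked_local (x' : V -> 'F_2) (p q : node) :
  (forall v, touches p v -> x' v = x v) ->
  linked t t' x p q -> linked t t' x' p q.
Proof.
case: p q => [w|[v j]] [w'|[v' j']] //= xx'; last by rewrite xx'.
case/andP=> -> /forallP eqw; apply/forallP => v; apply/implyP => cv.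
by rewrite xx' // (implyP (eqw v)).
Qed.

Lemma linked_sym (p q : node) : linked t t' x p q -> linked t' t x q p.
Proof.
case: p q => [w|[v j]] [w'|[v' j']] //=.
  case/andP=> /eqP-> /forallP eqw; rewrite eqxx; apply/forallP => v.
  apply/implyP => cv; rewrite -F2_eq_add (eqP (implyP (eqw v) cv)).
  by rewrite [x v + t' _ v + _]addrAC.
by case/andP=> /eqP-> /eqP->; rewrite eqxx F2_addrK eqxx.
Qed.

Lemma linked_inj (p q q' : node) :
  linked t t' x p q -> linked t t' x p q' -> q = q'.
Proof.
case: p q q' => [w|[v j]] [w1|[v1 j1]] // [w2|[v2 j2]] //=.
  case/andP=> /eqP cc1 /forallP eqw1 /andP[/eqP cc2 /forallP eqw2].
  congr inl; apply: gadget_eq; rewrite ?cc1 // => v cv.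
  by rewrite (eqP (implyP (eqw1 v) cv)) (eqP (implyP (eqw2 v) cv)).
by case/andP=> /eqP-> /eqP-> /andP[/eqP-> /eqP->].
Qed.

Lemma linked_adj (p q p' q' : node) :
  linked t t' x p q -> linked t t' x p' q' ->
  node_adj t' q q' = node_adj t p p'.
Proof.
have F2_cancel (a b c d e : 'F_2) :
    (a + (b + c + d) + d == e + b) = (a + c == e).
  rewrite (addrC b c) -[X in X == _]addrA F2_addrK addrA.
  by rewrite (inj_eq (addIr b)).
case: p q p' q' => [w|[v j]] [w1|[v1 j1]] // [w'|[v' j']] [w1'|[v1' j1']] //=.
  case/andP=> /eqP-> /forallP eqw /andP[/eqP-> /eqP->].
  case cv: (inc _ v') => //=.
  by rewrite (eqP (implyP (eqw v') cv)) F2_cancel.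
move=> /andP[/eqP-> /eqP->] /andP[/eqP-> /forallP eqw].
case cv: (inc _ v) => //=.
by rewrite (eqP (implyP (eqw v) cv)) F2_cancel.
Qed.

Lemma linked_le (leC : rel C) (leV : rel V) (p q p' q' : node) :
  linked t t' x p q -> linked t t' x p' q' ->
  node_le leC leV q q' = node_le leC leV p p'.
Proof.
case: p q p' q' => [w|[v j]] [w1|[v1 j1]] // [w'|[v' j']] [w1'|[v1' j1']] //=.
  by move=> /andP[/eqP-> _] /andP[/eqP-> _].
by move=> /andP[/eqP-> _] /andP[/eqP-> _].
Qed.

End Linked.

Lemma linked_eq (t t' : C -> V -> 'F_2) x (p q p' q' : node) :
  linked t t' x p q -> linked t t' x p' q' -> (q == q') = (p == p').
Proof.
move=> pq pq'; apply/eqP/eqP => [qq'|pp']; subst.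
  exact: linked_inj (linked_sym pq) (linked_sym pq').
exact: linked_inj pq pq'.
Qed.

(** The bijection is glued from many flips: the gadgets of [c] use [X c], the variable nodes use
    [x]. Each [X c] has to meet only its own constraint, so no global solution is required. *)
Lemma linked_bij (t t' : C -> V -> 'F_2) (x : V -> 'F_2)
    (X : C -> V -> 'F_2) :
  (forall c, \sum_(v | inc c v) (X c v + t c v + t' c v) = 0) ->
  exists2 beta : node -> node, bijective beta &
    forall p, linked t t' (if p is inl w then X (val w).1 else x) p (beta p).
Proof.
move=> X0.
have ex_img p : exists q,
    linked t t' (if p is inl w then X (val w).1 else x) p q.
  case: p => [w|[v j]]; last by exists (inr (v, j + x v)); rewrite /= !eqxx.
  have [|w' [cw' eqw']] := @gadget_exists (val w).1 (fun v => (val w).2 v +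
      (X (val w).1 v + t (val w).1 v + t' (val w).1 v)).
    by rewrite big_split /= X0 gadget_sum addr0.
  exists (inl w') => /=; rewrite cw' eqxx; apply/forallP => v.
  by apply/implyP => /eqw'->.
have [beta link_beta] := fin_all_exists ex_img.
exists beta => //; apply: injF_bij => p p' eq_beta.
have := link_beta p; have := link_beta p'; rewrite eq_beta.
case: p p' {eq_beta} => [w|[v j]] [w'|[v' j']]; case: (beta _) => [w1|[v1 j1]] //.
  (* Gadgets with a common image share their constraint, so both links use the same flip and can be
     inverted. *)
  move=> l' l; have /= /andP[/eqP cw' _] := l'; have /= /andP[/eqP cw _] := l.
  rewrite -cw' cw in l'.
  exact: linked_inj (linked_sym l) (linked_sym l').
move=> l' l; exact: linked_inj (linked_sym l) (linked_sym l').
Qed.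

(** The preorder keeps every node in its class, so [h] translates each variable pair by some [x v];
    adjacency then determines [h] on the gadgets. *)
Lemma node_iso_linked (t t' : C -> V -> 'F_2) (leC : rel C) (leV : rel V)
    (h : node -> node) :
  total_preorder leC -> total_preorder leV ->
  antisymmetric leC -> antisymmetric leV -> bijective h ->
  (forall p q, node_adj t' (h p) (h q) = node_adj t p q) ->
  (forall p q, node_le leC leV (h p) (h q) = node_le leC leV p q) ->
  exists x : V -> 'F_2, forall p, linked t t' x p (h p).
Proof.
move=> tC tV aC aV bij_h h_adj h_le.
(* The preorder does not depend on the twist, so [h] is an automorphism of it even when [t] and [t']
   differ. *)
have orig p := node_le_equiv aC aV
  (preorder_aut_class (node_le_total tC tV) bij_h h_le p).
have ex_x v : exists xv, forall j, h (inr (v, j)) = inr (v, j + xv).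
  have := orig (inr (v, 0)); case E0: (h _) => [//|[v0 xv]] vv0; subst v0.
  have := orig (inr (v, 1)); case E1: (h _) => [//|[v1 yv]] vv1; subst v1.
  exists xv => j; have [->|/F2_neq0->] := eqVneq j 0; first by rewrite add0r.
  rewrite E1; congr (inr (_, _)).
  (* The two nodes of [v] have different images, so [xv] and [yv] differ by 1. *)
  have neq : yv + xv != 0.
    apply/eqP => /(congr1 (fun z => z + xv)); rewrite F2_addrK add0r => yx.
    by move: E1; rewrite yx -E0 => /(bij_inj bij_h).
  by rewrite -[LHS](F2_addrK yv xv) (F2_neq0 neq).
have [x hx] := fin_all_exists ex_x; exists x.
case=> [w|[v j]]; last by rewrite hx /= !eqxx.
have := orig (inl w); case Ew: (h _) => [w'|//] cw'; rewrite /= cw' eqxx /=.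
apply/forallP => v; apply/implyP => cv.
(* The node of [v] adjacent to [w] must go to the one adjacent to [w'], which fixes the entry of
   [w'] at [v]. *)
have := h_adj (inl w) (inr (v, (val w).2 v + t (val w').1 v)).
rewrite Ew hx /= cw' cv eqxx /= => /eqP eqw.
by rewrite -(inj_eq (addIr (t' (val w').1 v))) eqw !addrA F2_addrK addrAC.
Qed.

End System.

(** * Structures of gadget systems and the pebble game *)

Section SystemStructure.
Variables (C V : finType) (inc : C -> V -> bool).
Variables (leC : rel C) (leV : rel V) (mark : pred C).

(** The mark selects the nodes that the interpretation will keep. *)
Definition node_marked (p : node inc) : bool :=
  if p is inl w then mark (val w).1 else true.

(* The single ternary relation encodes a unary one on triples [(a, a, a)] and
   the adjacency on triples [(a, b, b)]. *)
Definition node_R (t : C -> V -> 'F_2) (a b c : node inc) : bool :=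
  (b == c) && (if a == b then node_marked a else node_adj t a b).

Definition system_holds (t : C -> V -> 'F_2) (s : sig_R_preceq) :
    (arity s).-tuple (node inc) -> bool :=
  match s with
  | symR => fun z => if tval z is [:: a; b; c] then node_R t a b c else false
  | symPreceq => fun z =>
      if tval z is [:: a; b] then node_le leC leV a b else false
  end.

Definition system_structure (t : C -> V -> 'F_2) : structure sig_R_preceq :=
  @Structure sig_R_preceq (node inc) (system_holds t).

Lemma system_iso_adj (t t' : C -> V -> 'F_2)
    (h : system_structure t -> system_structure t') :
  is_iso h -> forall p q, node_adj t' (h p) (h q) = node_adj t p q.
Proof.
case=> bij_h hol p q; have := hol symR [tuple p; q; q].
rewrite /= /node_R !eqxx (bij_eq bij_h) /=.
(* For [p = q] the triple encodes the mark, but there both adjacencies are false. *)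
have irr u r : @node_adj C V inc u r r = false by case: r => [w|[v j]].
by case: eqP => [-> _|//]; rewrite !irr.
Qed.

Lemma system_iso_le (t t' : C -> V -> 'F_2)
    (h : system_structure t -> system_structure t') :
  is_iso h ->
  forall p q, node_le leC leV (h p) (h q) = node_le leC leV p q.
Proof. by case=> _ hol p q; exact: (hol symPreceq [tuple p; q]). Qed.

Lemma system_iso_linked (t t' : C -> V -> 'F_2)
    (h : system_structure t -> system_structure t') :
  total_preorder leC -> total_preorder leV ->
  antisymmetric leC -> antisymmetric leV -> is_iso h ->
  exists x : V -> 'F_2, forall p, linked t t' x p (h p).
Proof.
move=> tC tV aC aV iso_h.
exact: (node_iso_linked tC tV aC aV (proj1 iso_h) (system_iso_adj iso_h)
  (system_iso_le iso_h)).
Qed.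

Lemma system_iso_constraint (t t' : C -> V -> 'F_2) :
  total_preorder leC -> total_preorder leV ->
  antisymmetric leC -> antisymmetric leV ->
  isomorphic (system_structure t) (system_structure t') ->
  exists x : V -> 'F_2,
    forall c, \sum_(v | inc c v) (x v + t c v + t' c v) = 0.
Proof.
move=> tC tV aC aV [h iso_h].
have [x link] := system_iso_linked tC tV aC aV iso_h; exists x => c.
(* The zero vector gives every constraint a gadget, whose image certifies the constraint. *)
have [|w [cw _]] := @gadget_exists C V inc c (fun=> 0); first exact: big1.
by have := linked_sum (link (inl w)); rewrite cw.
Qed.

(** For an automorphism the two twists cancel, so its flip solves the homogeneous system and
    vanishes. *)
Lemma system_asymmetric (t : C -> V -> 'F_2) :
  total_preorder leC -> total_preorder leV ->
  antisymmetric leC -> antisymmetric leV ->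
  (forall x : V -> 'F_2,
     (forall c, \sum_(v | inc c v) x v = 0) -> forall v, x v = 0) ->
  asymmetric (system_structure t).
Proof.
move=> tC tV aC aV ker0 h iso_h p.
have [x link] := system_iso_linked tC tV aC aV iso_h.
have x0 : forall v, x v = 0.
  apply: ker0 => c.
  have [|w [cw _]] := @gadget_exists C V inc c (fun=> 0); first exact: big1.
  rewrite -[RHS](linked_sum (link (inl w))) cw.
  by apply: eq_bigr => v _; rewrite F2_addrK.
apply: linked_inj (link p) _; case: p => [w|[v j]] /=.
  rewrite eqxx; apply/forallP => v; apply/implyP => _.
  by rewrite x0 add0r F2_addrr addr0.
by rewrite x0 addr0 !eqxx.
Qed.

Lemma linked_holds (t t' : C -> V -> 'F_2) x (s : sig_R_preceq)
    (z z' : (arity s).-tuple (node inc)) :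
  all2 (linked t t' x) z z' -> system_holds t' z' = system_holds t z.
Proof.
case: s z z' => [] [z hz] [z' hz'] /=.
  case: z z' {hz hz'} => [|a [|b [|c [|? ?]]]] [|a' [|b' [|c' [|? ?]]]] //=;
    rewrite ?andbF // => /and4P[la lb lc _].
  rewrite /node_R (linked_eq lb lc) (linked_eq la lb) (linked_adj la lb).
  have -> // : node_marked a' = node_marked a.
  by case: a a' la => [w|[v j]] [w'|[v' j']] //= /andP[/eqP-> _].
case: z z' {hz hz'} => [|a [|b [|? ?]]] [|a' [|b' [|? ?]]] //=;
  rewrite ?andbF // => /and3P[la lb _].
exact: linked_le la lb.
Qed.

Definition opt_linked (t t' : C -> V -> 'F_2) (x : V -> 'F_2)
    (o o' : option (node inc)) : bool :=
  match o, o' with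
  | Some p, Some q => linked t t' x p q
  | None, None => true
  | _, _ => false
  end.

Lemma opt_linked_sym (t t' : C -> V -> 'F_2) x o o' :
  opt_linked t t' x o o' -> opt_linked t' t x o' o.
Proof. by case: o o' => [p|] [q|] //=; apply: linked_sym. Qed.

Lemma opt_linked_map (t t' : C -> V -> 'F_2) x k
    (nu nu' : nat -> option (node inc)) (xs : seq nat) (z : seq (node inc)) :
  (forall i, (i < k)%N -> opt_linked t t' x (nu i) (nu' i)) ->
  all (fun i => i < k)%N xs -> map nu xs = map Some z ->
  exists2 z', map nu' xs = map Some z' & all2 (linked t t' x) z z'.
Proof.
move=> link; elim: xs z => [|i xs IHxs] [|a z] //=; first by exists [::].
case/andP=> /link li /IHxs{}IHxs [nui /IHxs[z' nuz' lz]].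
move: li; rewrite nui; case nu'i: (nu' i) => [a'|//] /= la.
by exists (a' :: z'); rewrite /= ?nu'i ?nuz' ?la.
Qed.

(** * Duplicator's strategy in the bijective pebble game *)

Section Game.
Variable k : nat.

(** This is what the game asks of the incidence relation: room to move a violated constraint away
    from the pebbles. *)
Hypothesis free_variable : forall c (P : seq (node inc)),
  (size P < k)%N ->
  all (fun p => if p is inl w then (val w).1 != c else true) P ->
  exists2 v, inc c v & all (fun p => ~~ touches p v) P.

(* If the constraint [c] fails for [x], no pebble lies on its gadget, and
   flipping a variable that no pebble sees repairs it. *)
Lemma game_repair (t t' : C -> V -> 'F_2) (x : V -> 'F_2) c
    (P : seq (node inc)) :
  (size P < k)%N -> (forall p, p \in P -> exists q, linked t t' x p q) ->
  exists x' : V -> 'F_2,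
    \sum_(v | inc c v) (x' v + t c v + t' c v) = 0 /\
    forall p v, p \in P -> touches p v -> x' v = x v.
Proof.
move=> szP linkP; pose S x' := \sum_(v | inc c v) (x' v + t c v + t' c v).
have [Sx0|/F2_neq0 Sx1] := eqVneq (S x) 0; first by exists x.
have [|v cv /allP nPv] := free_variable (c := c) szP.
  apply/allP => -[w|//] /linkP[q /linked_sum w0]; apply/eqP => cw.
  by move: Sx1; rewrite /S -cw w0 => /eqP.
(* Flipping the untouched variable [v] of [c] changes the sum from 1 to 0. *)
exists (fun u => x u + (u == v)%:R); split=> [|p u pP pu].
  rewrite (eq_bigr (fun u => (x u + t c u + t' c u) + (u == v)%:R)); last first.
    by move=> u _; rewrite [x u + _%:R]addrC -!addrA addrC -!addrA.
  rewrite big_split /=; rewrite -/(S x) Sx1 (bigD1 v) //= eqxx big1 ?addr0.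
    exact: F2_addrr.
  by move=> u /andP[_ /negPf->].
case: eqVneq => [uv|]; last by rewrite addr0.
by move: (nPv p pP); rewrite -uv pu.
Qed.

(** Once pebble [i] is lifted, fewer than [k] remain, so every constraint [c] has its own repair
    [X c] of [x]. These repairs glue to a bijection answering all choices of [a] at once. *)
Lemma game_step (t t' : C -> V -> 'F_2) (x : V -> 'F_2)
    (nu nu' : nat -> option (node inc)) i :
  (i < k)%N ->
  (forall j, (j < k)%N -> opt_linked t t' x (nu j) (nu' j)) ->
  exists2 beta : node inc -> node inc, bijective beta &
    forall a, exists x', forall j, (j < k)%N ->
      opt_linked t t' x' (update nu i a j) (update nu' i (beta a) j).
Proof.
move=> ik link; pose P := pmap nu [seq j <- iota 0 k | j != i].
have szP : (size P < k)%N.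
  rewrite size_pmap (leq_ltn_trans (count_size _ _)) // size_filter.
  rewrite -[ltnRHS](size_iota 0 k) -(count_predC (pred1 i)) -add1n leq_add2r.
  by rewrite -has_count has_pred1 mem_iota.
have memP j p : (j < k)%N -> j != i -> nu j = Some p -> p \in P.
  move=> jk ji nuj; rewrite mem_pmap; apply/mapP; exists j => //.
  by rewrite mem_filter ji mem_iota.
have linkP p : p \in P -> exists q, linked t t' x p q.
  rewrite mem_pmap => /mapP[j]; rewrite mem_filter mem_iota.
  case/andP=> _ /link + pj; rewrite -pj.
  by case: (nu' j) => // q lpq; exists q.
have [X hX] := fin_all_exists (fun c => game_repair c szP linkP).
have [beta bij_beta link_beta] := linked_bij x (fun c => proj1 (hX c)).
exists beta => // a.
(* The new flip is the repair for the constraint of the new pebble; it agrees with [x] on all that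
   the old pebbles touch. *)
exists (if a is inl w then X (val w).1 else x) => j jk; rewrite /update.
have [_|ji] := eqVneq j i; first exact: link_beta.
have := link j jk; case nuj: (nu j) (nu' j) => [p|] [q|] //=.
apply: linked_local => v pv; case: (a) => [w|_] //.
by have [_ /(_ p v)] := hX (val w).1; apply=> //; apply: memP nuj.
Qed.

Lemma game_eval (p : formula sig_R_preceq) :
  all (fun i => i < k)%N (vars p) ->
  forall (t t' : C -> V -> 'F_2) (nu nu' : nat -> option (node inc)),
  (exists x, forall i, (i < k)%N -> opt_linked t t' x (nu i) (nu' i)) ->
  eval (A := system_structure t) nu p = eval (A := system_structure t') nu' p.
Proof.
elim: p => [i j|s xs|q IHq|q IHq r IHr|i q IHq|m i q IHq].
- move=> /and3P[ik jk _] t t' nu nu' [x link].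
  rewrite !eval_FEq; have := link j jk; have := link i ik.
  case: (nu i) (nu' i) => [a|] [a'|] //; case: (nu j) (nu' j) => [b|] [b'|] //=.
  by move=> la lb; rewrite !andbT !(inj_eq (@Some_inj _)) (linked_eq la lb).
- move=> xsk t t' nu nu' [x link].
  suff imp t1 t2 nu1 nu2 :
      (forall i, (i < k)%N -> opt_linked t1 t2 x (nu1 i) (nu2 i)) ->
      eval (A := system_structure t1) nu1 (FRel xs) ->
      eval (A := system_structure t2) nu2 (FRel xs).
    apply/idP/idP; apply: imp => // i ik; exact: opt_linked_sym (link i ik).
  move=> link12 ev1; have /existsP[z /andP[/eqP nuz hz]] := ev1.
  have [z' nuz' lz] := opt_linked_map link12 xsk nuz.
  have szz' : size z' == arity s.
    by rewrite -(size_map Some z') -nuz' size_map size_tuple.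
  rewrite (eval_FRel (A := system_structure t2) (z := Tuple szz') nuz') /=.
  by rewrite (linked_holds (z := z) (z' := Tuple szz') lz).
- by move=> qk t t' nu nu' link /=; rewrite (IHq qk _ _ _ _ link).
- rewrite /= all_cat => /andP[qk rk] t t' nu nu' link.
  by rewrite (IHq qk _ _ _ _ link) (IHr rk _ _ _ _ link).
- move=> /andP[ik qk] t t' nu nu' [x link] /=.
  have [beta [beta' betaK beta'K] step] := game_step ik link.
  apply/existsP/existsP => -[a eva]; [exists (beta a)|exists (beta' a)].
    by rewrite -(IHq qk _ _ _ _ (step a)).
  by rewrite (IHq qk _ _ _ _ (step (beta' a))) beta'K.
- move=> /andP[ik qk] t t' nu nu' [x link] /=.
  have [beta bij_beta step] := game_step ik link.
  (* The bijection matches the witnesses on both sides, so their numbers agree. *)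
  congr (m <= _)%N.
  set Q' := [pred a | eval (A := system_structure t') _ q].
  rewrite -(on_card_preimset (onW_bij Q' bij_beta)).
  by apply: eq_card => a; rewrite !inE (IHq qk _ _ _ _ (step a)).
Qed.

Lemma system_Ck_equiv (t t' : C -> V -> 'F_2) :
  Ck_equiv k (system_structure t) (system_structure t').
Proof.
move=> p /andP[pk _]; apply: game_eval => //.
(* No pebble is placed yet, so any flip will do. *)
by exists (fun=> 0); case.
Qed.

End Game.

(** A pebble touches at most one variable of [c]: its own if it lies on a variable node, the only
    common one if it lies on a gadget of another constraint. Fewer than [k] pebbles cannot touch
    them all. *)
Lemma linear_space_free_variable (k : nat) :
  (forall c, k <= #|[pred v | inc c v]|)%N ->
  (forall c c' v v', c != c' ->
     inc c v -> inc c' v -> inc c v' -> inc c' v' -> v = v') ->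
  forall c (P : seq (node inc)), (size P < k)%N ->
    all (fun p => if p is inl w then (val w).1 != c else true) P ->
    exists2 v, inc c v & all (fun p => ~~ touches p v) P.
Proof.
move=> inc_k inc_lin c P szP Pc.
pose seen (Q : seq (node inc)) :=
  [set v | inc c v & has (fun p => touches p v) Q].
have card_seen Q :
    all (fun p => if p is inl w then (val w).1 != c else true) Q ->
    (#|seen Q| <= size Q)%N.
  elim: Q => [_|p Q IHQ /= /andP[pc /IHQ{}IHQ]].
    by rewrite leqn0 cards_eq0; apply/eqP/setP => v; rewrite !inE andbF.
  have -> : seen (p :: Q) = [set v | inc c v & touches p v] :|: seen Q.
    by apply/setP => v; rewrite !inE /= andb_orr.
  rewrite (leq_trans (leq_card_setU _ _)) // -add1n leq_add //.
  apply/card_le1_eqP => u v; rewrite !inE => /andP[cu pu] /andP[cv pv].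
  case: p pc pu pv => [w|[v' j]] /= pc; last by move=> /eqP-> /eqP->.
  by move=> wu wv; apply: (inc_lin c (val w).1) => //; rewrite eq_sym.
have lt_seen : (#|seen P| < #|[pred v | inc c v]|)%N.
  exact: leq_ltn_trans (card_seen P Pc) (leq_trans szP (inc_k c)).
have : ~~ ([pred v | inc c v] \subset seen P).
  by apply: contraTN lt_seen => /subset_leq_card; rewrite -leqNgt.
case/subsetPn => v; rewrite !inE => cv; rewrite cv /= => nPv.
by exists v => //; rewrite all_predC.
Qed.

End SystemStructure.

(** * CFI graphs inside larger gadget systems *)

Lemma order_total_preorder (disp : Order.disp_t) (T : orderType disp) :
  total_preorder (<=%O : rel T).
Proof. by split; [apply: lexx|apply: le_trans|apply: le_total]. Qed.

Section Expansion.
Variable H : ordered_base_graph.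

(* The pair of a base edge [e] is named from its smaller end, so [f e] shows up
   only in the adjacency with the gadget of the larger end. *)
Definition edge_twist (f : base_edge H -> 'F_2) (u : H) (e : base_edge H) :
    'F_2 :=
  if u == (val e).1 then 0 else f e.

Definition edge_le : rel (base_edge H) :=
  fun e e' =>
  ((val e).1 < (val e').1)%O
  || ((val e).1 == (val e').1) && ((val e).2 <= (val e').2)%O.

Lemma edge_leE (e e' : base_edge H) :
  edge_le e e' = ((val e : H *l H) <= val e')%O.
Proof. by rewrite Order.ProdLexiOrder.leEprodlexi /edge_le; case: ltgtP. Qed.

Lemma edge_le_total : total_preorder edge_le.
Proof.
split=> [e|e e1 e2|e e']; rewrite !edge_leE ?lexx //.
  exact: le_trans.
exact: le_total.
Qed.

Lemma edge_le_anti : antisymmetric edge_le.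
Proof. by move=> e e'; rewrite !edge_leE => /le_anti /val_inj. Qed.

Lemma CFI_leE (p q : CFI_vertex H) :
  CFI_le p q = node_le (inc := @incident H) <=%O edge_le p q.
Proof. by case: p q => [w|[e j]] [w'|[e' j']]. Qed.

(** Contraction collapses the matching edges, which carry [f], and keeps the gadget edges; the names
    of the contracted pairs move [f] to the larger ends. *)
Lemma CFI_adjE (f : base_edge H -> 'F_2) (p q : CFI_vertex H) :
  CFI_adj f p q = node_adj (inc := @incident H) (edge_twist f) p q.
Proof.
have twist_name (b : 'F_2) u (e : base_edge H) :
    (if u == (val e).1 then b else b + f e) = b + edge_twist f u e.
  by rewrite /edge_twist; case: ifP; rewrite ?addr0.
have outer (w : gadget_vertex H) e : incident (val w).1 e ->
    exists a : outer_vertex H, val a = ((val w).1, e, (val w).2 e).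
  by move=> we; exists (exist _ ((val w).1, e, (val w).2 e) we).
rewrite /CFI_adj; case: p q => [w|[e j]] [w'|[e' j']] /=.
- apply/negP => /andP[_ /existsP[x /existsP[y /and3P[/eqP xp /eqP yq]]]].
  by case: x y xp yq => [w1|[[[u e] j] ?]] [w2|[[[u2 e2] j2] ?]].
- apply/existsP/andP => /= [[x /existsP[y /and3P[/eqP xp /eqP yq]]]|[we /eqP wj]].
    case: x y xp yq => [w1|[[[u1 e1] j1] i1]] [w2|[[[u2 e2] j2] i2]] //= [Ew].
    case=> Ee Ej /andP[/eqP uw /eqP wj2]; move: i2 => /=; subst w1 e2 u2.
    by move=> i2; rewrite i2 wj2 -twist_name Ej.
  have [a Ea] := outer w e' we.
  exists (inl w); apply/existsP; exists (inr a) => /=.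
  by rewrite Ea !eqxx twist_name wj !eqxx.
- apply/existsP/andP => /= [[x /existsP[y /and3P[/eqP xp /eqP yq]]]|[we /eqP wj]].
    case: x y xp yq => [w1|[[[u1 e1] j1] i1]] [w2|[[[u2 e2] j2] i2]] //= [Ee Ej].
    case=> Ew /andP[/eqP uw /eqP wj2]; move: i1 => /=; subst w2 e1 u1.
    by move=> i1; rewrite i1 wj2 -twist_name Ej.
  have [a Ea] := outer w' e we.
  exists (inr a); apply/existsP; exists (inl w') => /=.
  by rewrite Ea !eqxx twist_name wj !eqxx.
- apply/negP => /andP[/eqP neq /existsP[x /existsP[y /and3P[/eqP xp /eqP yq]]]].
  move=> adj; apply: neq; rewrite -xp -yq; apply/CFI_contract_fibre; right.
  by case: x y xp yq adj => [w1|a1] [w2|a2] // *; exists a1, a2.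
Qed.

Lemma sum_incident (y : H -> base_edge H -> 'F_2) :
  \sum_u \sum_(e | incident u e) y u e =
  \sum_e (y (val e).1 e + y (val e).2 e).
Proof.
rewrite (exchange_big_dep predT) //=; apply: eq_bigr => e _.
rewrite (bigD1 (val e).1) /=; last by rewrite /incident eqxx.
rewrite (bigD1 (val e).2) /=; last by rewrite /incident eqxx orbT base_edge_neq.
rewrite big1 ?addr0 // => u /andP[/andP[+ /negPf u1] /negPf u2].
by rewrite /incident u1 u2.
Qed.

(** In the sum over all base vertices, [x e] occurs at both ends of [e] and cancels, whereas [f e]
    and [g e] occur once, at the larger end. *)
Lemma twist_parity (f g : base_edge H -> 'F_2) (x : base_edge H -> 'F_2) :
  (forall u, \sum_(e | incident u e)
     (x e + edge_twist f u e + edge_twist g u e) = 0) ->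
  \sum_e f e = \sum_e g e.
Proof.
move=> x0; have : \sum_u \sum_(e | incident u e)
    (x e + edge_twist f u e + edge_twist g u e) = 0 by rewrite big1.
rewrite sum_incident (eq_bigr (fun e => f e + g e)); last first.
  move=> e _; rewrite /edge_twist eqxx base_edge_neq !addr0.
  by rewrite !addrA F2_addrr add0r.
by rewrite big_split /= => fg0; rewrite -[LHS](F2_addrK _ (\sum_e g e)) fg0 add0r.
Qed.

Lemma CFI_iso_parity (f g : base_edge H -> 'F_2) :
  isomorphic (CFI f) (CFI g) -> \sum_e f e = \sum_e g e.
Proof.
case=> h [bij_h hol].
have h_adj p q : node_adj (inc := @incident H) (edge_twist g) (h p) (h q) =
    node_adj (inc := @incident H) (edge_twist f) p q.
  by rewrite -!CFI_adjE; exact: (hol symE [tuple p; q]).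
have h_le p q : node_le (inc := @incident H) <=%O edge_le (h p) (h q) =
    node_le (inc := @incident H) <=%O edge_le p q.
  by rewrite -!CFI_leE; exact: (hol symLe [tuple p; q]).
have [x link] := node_iso_linked (order_total_preorder H) edge_le_total
  (@le_anti _ H) edge_le_anti bij_h h_adj h_le.
apply: (twist_parity (x := x)) => u.
have [|w [cw _]] := @gadget_exists H _ (@incident H) u (fun=> 0).
  exact: big1.
by have := linked_sum (link (inl w)); rewrite cw.
Qed.

Variables (L : finType) (on : L -> base_edge H -> bool).

(** The constraints of [L] are meant to destroy the automorphisms of the CFI graph. *)
Definition expanded_inc (c : H + L) (e : base_edge H) : bool :=
  match c with inl u => incident u e | inr l => on l e end.

(** [L] carries no order of its own; its enumeration supplies one. *)
Definition expanded_le : rel (H + L) :=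
  fun c c' =>
  match c, c' with
  | inl u, inl u' => (u <= u')%O
  | inl _, inr _ => true
  | inr _, inl _ => false
  | inr l, inr l' => (enum_rank l <= enum_rank l')%N
  end.

Definition expanded_twist (f : base_edge H -> 'F_2) (c : H + L)
    (e : base_edge H) : 'F_2 :=
  if c is inl u then edge_twist f u e else 0.

Definition CFI_expansion (f : base_edge H -> 'F_2) : structure sig_R_preceq :=
  system_structure expanded_inc expanded_le edge_le
    (fun c => if c is inl _ then true else false) (expanded_twist f).

Lemma expanded_le_total : total_preorder expanded_le.
Proof.
split.
- by case=> [u|l] /=; [apply: lexx|apply: leqnn].
- by case=> [u|l] [u'|l'] [u''|l''] //=; [apply: le_trans|apply: leq_trans].
- by case=> [u|l] [u'|l'] //=; [apply: le_total|apply: leq_total].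
Qed.

Lemma expanded_le_anti : antisymmetric expanded_le.
Proof.
case=> [u|l] [u'|l'] //=; first by move=> /le_anti ->.
by rewrite -eqn_leq => /eqP/val_inj/enum_rank_inj->.
Qed.

Lemma CFI_expansion_total (f : base_edge H -> 'F_2) :
  total_preorder (preceq (CFI_expansion f)).
Proof. exact: (@node_le_total _ _ expanded_inc _ _ expanded_le_total edge_le_total). Qed.

Lemma CFI_expansion_iso_parity (f g : base_edge H -> 'F_2) :
  isomorphic (CFI_expansion f) (CFI_expansion g) -> \sum_e f e = \sum_e g e.
Proof.
case/(system_iso_constraint expanded_le_total edge_le_total expanded_le_anti
  edge_le_anti) => x x0.
by apply: (twist_parity (x := x)) => u; apply: (x0 (inl u)).
Qed.

End Expansion.

(** * Recovering the CFI graph by first-order formulas *)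

Definition CFI_formula (s : sig_graph) : formula sig_R_preceq :=
  match s with
  | symE =>
      FAnd (@FRel sig_R_preceq symR [tuple 0%N; 1%N; 1%N]) (FNot (FEq _ 0 1))
  | symLe => @FRel sig_R_preceq symPreceq [tuple 0%N; 1%N]
  end.

Lemma CFI_formula_first_order (s : sig_graph) : first_order (CFI_formula s).
Proof. by case: s. Qed.

Lemma CFI_formula_free_vars (s : sig_graph) :
  all (fun x => x < arity s)%N (free_vars (CFI_formula s)).
Proof. by case: s. Qed.

(** The diagonal of [R] holds the mark and thus defines the domain; adjacency is read from triples
    [(a, b, b)] with distinct [a] and [b]. *)
Definition CFI_interpretation : FO_interpretation sig_R_preceq sig_graph :=
  @FOInterpretation sig_R_preceq sig_graph
    (@FRel sig_R_preceq symR [tuple 0%N; 0%N; 0%N]) CFI_formula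
    isT isT CFI_formula_first_order CFI_formula_free_vars.

Section Interpretation.
Variables (H : ordered_base_graph) (L : finType) (on : L -> base_edge H -> bool).
Variable f : base_edge H -> 'F_2.

Let A := CFI_expansion on f.

Definition CFI_embed (p : CFI_vertex H) : A :=
  match p with
  | inl w => inl (exist _ (inl (val w).1, (val w).2) (valP w))
  | inr a => inr a
  end.

Lemma CFI_embed_inj : injective CFI_embed.
Proof.
case=> [w|a] [w'|a'] //=; last by case=> ->.
case=> cw bw; congr inl; apply: val_inj.
by case: w w' cw bw => [[u b] ?] [[u' b'] ?] /= -> ->.
Qed.

Lemma CFI_domain (v : A) :
  sat [:: v] (dom_formula CFI_interpretation) =
  if v is inl w then (if (val w).1 is inl _ then true else false) else true.
Proof.
rewrite /sat (@eval_FRel _ A _ symR _ [tuple v; v; v]) //=.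
by rewrite /node_R !eqxx.
Qed.

Lemma CFI_embed_domain (p : CFI_vertex H) :
  sat [:: CFI_embed p] (dom_formula CFI_interpretation).
Proof. by rewrite CFI_domain; case: p. Qed.

Lemma sat_adj (a b : A) :
  sat [:: a; b] (CFI_formula symE) =
  (a != b) && node_adj (expanded_twist f) a b.
Proof.
transitivity (eval (A := A) (onth [:: a; b])
    (@FRel sig_R_preceq symR [tuple 0%N; 1%N; 1%N]) &&
  ~~ eval (A := A) (onth [:: a; b]) (FEq _ 0 1)); first by [].
rewrite (@eval_FRel _ A _ symR _ [tuple a; b; b]) // eval_FEq /= andbT.
rewrite (inj_eq (@Some_inj _)) /node_R eqxx /= andbC.
by case: (eqVneq a b).
Qed.

Lemma sat_le (a b : A) :
  sat [:: a; b] (CFI_formula symLe) =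
  node_le (@expanded_le H L) (@edge_le H) a b.
Proof. by rewrite /sat (@eval_FRel _ A _ symPreceq _ [tuple a; b]). Qed.

Lemma CFI_interpretation_iso :
  isomorphic (image_structure CFI_interpretation A) (CFI f).
Proof.
apply: isomorphic_sym.
pose h p : image_structure CFI_interpretation A :=
  exist _ (CFI_embed p) (CFI_embed_domain p).
exists h; split.
  have surj y : exists p, h p = y.
    case: y => v dv; suff [p pv] : exists p, CFI_embed p = v.
      by exists p; apply: val_inj.
    move: dv; rewrite CFI_domain; case: v => [[[[u|//] b] hw]|a] _.
      by exists (inl (exist _ (u, b) hw)); congr inl; apply: val_inj.
    by exists (inr a).
  have [g gK] := fin_all_exists surj; exists g => // p.
  by apply: CFI_embed_inj; rewrite -[LHS]/(val (h (g (h p)))) gK.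
move=> s [[|p [|q [|? ?]]] hz] //.
have -> : map_tuple h (Tuple hz) = [tuple h p; h q] by apply: val_inj.
case: s hz => hz; rewrite /holds /= !(tnth_nth p) /=.
  rewrite sat_adj CFI_adjE (inj_eq CFI_embed_inj).
  case: eqVneq => [->|_]; last by case: p q {hz} => [w|[e j]] [w'|[e' j']].
  by case: q {hz} => [w|[e j]].
by rewrite sat_le CFI_leE; case: p q {hz} => [w|[e j]] [w'|[e' j']].
Qed.

End Interpretation.

(** * The affine plane *)

Section Plane.
Variable p : nat.

Let vertex : finOrderType _ := (bool *l 'F_p)%type.

Definition biclique_adj : rel vertex := fun u v => u.1 != v.1.

Lemma biclique_adj_sym : symmetric biclique_adj.
Proof. by move=> u v; rewrite /biclique_adj eq_sym. Qed.

Lemma biclique_adj_irr : irreflexive biclique_adj.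
Proof. by move=> u; rewrite /biclique_adj eqxx. Qed.

Lemma biclique_nonempty : (0 < #|vertex|)%N.
Proof. by apply/card_gt0P; exists (false, 0). Qed.

Lemma biclique_connected (u v : vertex) : connect biclique_adj u v.
Proof.
case: (boolP (biclique_adj u v)) => [/connect1//|]; rewrite negbK => /eqP uv.
apply: (@connect_trans _ _ (~~ u.1, 0)); apply: connect1; rewrite /biclique_adj.
  by case: u.1.
by rewrite -uv; case: u.1.
Qed.

Definition biclique : ordered_base_graph :=
  OrderedBaseGraph biclique_adj_sym biclique_adj_irr biclique_nonempty
    biclique_connected.

(* The edges of the complete bipartite graph on two copies of the field are the
   points of the affine plane, and its vertices are the vertical and the
   horizontal lines. *)
Definition point (a b : 'F_p) : base_edge biclique :=
  exist _ ((false, a), (true, b)) isT.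

Lemma pointP (e : base_edge biclique) : exists a b, e = point a b.
Proof.
case: e => [[[i a] [j b]] he]; have := he; rewrite /biclique_adj.
by case: i j he => [] [] he //= _; exists a, b; apply: val_inj.
Qed.

Lemma point_inj (a b a' b' : 'F_p) :
  point a b = point a' b' -> a = a' /\ b = b'.
Proof. by case=> -> ->. Qed.

(** Pairs of slope and intercept. Slope 0 is excluded because the horizontal lines are already base
    vertices. *)
Definition slanted := {l : 'F_p * 'F_p | l.1 != 0}.

Definition on_slanted (l : slanted) (e : base_edge biclique) : bool :=
  (val e).2.2 == (val l).1 * (val e).1.2 + (val l).2.

Let inc := expanded_inc on_slanted.

Definition line_point (c : biclique + slanted) (i : 'F_p) :
    base_edge biclique :=
  match c with
  | inl (false, a) => point a i
  | inl (true, b) => point i b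
  | inr l => point i ((val l).1 * i + (val l).2)
  end.

Lemma line_point_inj (c : biclique + slanted) : injective (line_point c).
Proof. by case: c => [[[] a]|l] i j /point_inj[]. Qed.

Lemma inc_line_point (c : biclique + slanted) e :
  inc c e = (e \in [set line_point c i | i in 'F_p]).
Proof.
have [a [b ->]] := pointP e; apply/idP/imsetP => [|[i _ ->]].
  case: c => [[[] d]|l] /=.
  - by case/orP=> /eqP[] // ->; exists a.
  - by case/orP=> /eqP[] // ->; exists b.
  - by rewrite /on_slanted /= => /eqP->; exists a.
case: c => [[[] d]|l] /=; rewrite /incident /on_slanted /= ?eqxx ?orbT //.
Qed.

Lemma sum_line (c : biclique + slanted) (x : base_edge biclique -> 'F_2) :
  \sum_(e | inc c e) x e = \sum_i x (line_point c i).
Proof.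
rewrite (eq_bigl _ _ (inc_line_point c)) big_imset //=.
by move=> i j _ _; apply: line_point_inj.
Qed.

Lemma card_line (c : biclique + slanted) :
  #|[pred e | inc c e]| = #|'F_p|.
Proof.
rewrite (eq_card (B := mem [set line_point c i | i in 'F_p])) => [|e].
  exact: card_imset (@line_point_inj c).
by rewrite !inE -inc_line_point.
Qed.

Lemma line_linear (c c' : biclique + slanted) e e' :
  c != c' -> inc c e -> inc c' e -> inc c e' -> inc c' e' -> e = e'.
Proof.
have [a [b ->]] := pointP e; have [a' [b' ->]] := pointP e'.
have vert i d u v : inc (inl (i, d)) (point u v) = (d == if i then v else u).
  by case: i => /=; rewrite /incident /= !xpair_eqE /= ?orbF.
have slant l u v : inc (inr l) (point u v) = (v == (val l).1 * u + (val l).2).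
  by [].
have vs i d l : inc (inl (i, d)) (point a b) -> inc (inr l) (point a b) ->
    inc (inl (i, d)) (point a' b') -> inc (inr l) (point a' b') ->
    point a b = point a' b'.
  rewrite !vert !slant; case: i => /eqP-> /eqP lb /eqP eb /eqP lb'.
    suff -> : a = a' by rewrite eb.
    (* A nonzero slope makes the first coordinate recoverable from the second. *)
    by apply: (mulfI (valP l)); apply: (addIr (val l).2); rewrite -lb -lb'.
  by rewrite lb lb' eb.
case: c c' => [[i d]|l] [[i' d']|l'] neq.
- rewrite !vert; case: i i' neq => [] [] neq /eqP d1 /eqP d2 /eqP d3 /eqP d4;
    try by rewrite d1 d2 eqxx in neq.
    by rewrite -d1 -d2 d3 d4.
  by rewrite -d1 -d2 d3 d4.
- exact: vs.
- by move=> h1 h2 h3 h4; apply: (vs i' d' l).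
rewrite !slant => /eqP h1 /eqP h2 /eqP h3 /eqP h4.
have [aa'|naa'] := eqVneq a a'; first by rewrite h1 h3 aa'.
(* Two points in different columns determine the slope, and then the intercept. *)
have slope m c : b = m * a + c -> b' = m * a' + c -> b - b' = m * (a - a').
  by move=> -> ->; rewrite mulrBr opprD addrACA subrr addr0.
have eqm : (val l).1 = (val l').1.
  apply: (mulIf (x := a - a')); first by rewrite subr_eq0.
  by rewrite -(slope _ _ h1 h3) (slope _ _ h2 h4).
case/negP: neq; apply/eqP; congr inr; apply: val_inj.
rewrite [val l]surjective_pairing [val l']surjective_pairing -eqm.
congr (_, _); apply: (addrI ((val l).1 * a)).
by rewrite -h1 eqm -h2.
Qed.

(* Summing the constraints of all non-vertical lines through a point counts
   that point [p] times, which is odd, and every other column once. *)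
Lemma plane_kernel (x : base_edge biclique -> 'F_2) :
  prime p -> odd p ->
  (forall c, \sum_(e | inc c e) x e = 0) -> forall e, x e = 0.
Proof.
move=> p_pr p_odd x0 e; have [a [b ->]] := pointP e.
pose y u v := x (point u v).
have col0 u : \sum_v y u v = 0.
  by have := x0 (inl (false, u)); rewrite sum_line.
have line0 m c : \sum_u y u (m * u + c) = 0.
  have [->|m0] := eqVneq m 0.
    rewrite -[RHS](x0 (inl (true, c))) sum_line.
    by apply: eq_bigr => u _; rewrite mul0r add0r.
  by have := x0 (inr (exist _ (m, c) m0)); rewrite sum_line.
(* The intercept [b - m * a] makes the line of slope [m] pass through the point [(a, b)]. *)
have : \sum_m \sum_u y u (m * u + (b - m * a)) = 0 by rewrite big1.
rewrite exchange_big (bigD1 a) //= [X in _ + X]big1 => [|u ua].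
  rewrite addr0 (eq_bigr (fun=> y a b)) => [|m _]; last by rewrite addrC subrK.
  rewrite sumr_const card_Fp // -[p in _ *+ p](odd_double_half p) p_odd.
  by rewrite mulrnDr mulr1n -muln2 mulrnA mulr2n F2_addrr addr0.
rewrite -[RHS](col0 u) [RHS](reindex (fun m => m * u + (b - m * a))) //=.
(* The inverse sends [v] to the slope of the line joining [(a, b)] and [(u, v)]. *)
exists (fun v => (v - b) / (u - a)) => v _ /=.
  have -> : v * u + (b - v * a) - b = v * (u - a).
    by rewrite mulrBr addrA addrAC addrK.
  by rewrite mulfK // subr_eq0.
rewrite addrCA -mulrBr divfK ?subr_eq0 //.
by rewrite addrC subrK.
Qed.

End Plane.

(** * Choice of the prime and of the two twists *)

Theorem theorem7p20 :
  exists Theta : FO_interpretation sig_R_preceq sig_graph,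
  forall k : nat,
  exists A B : structure sig_R_preceq,
    [/\ total_preorder (preceq A) /\ total_preorder (preceq B),
        asymmetric A /\ asymmetric B,
        Ck_equiv k A B,
        ~ isomorphic A B
      & exists (H : ordered_base_graph) (f g : base_edge H -> 'F_2),
          [/\ isomorphic (image_structure Theta A) (CFI f),
              isomorphic (image_structure Theta B) (CFI g)
            & ~ isomorphic (image_structure Theta A) (image_structure Theta B)]].
Proof.
exists CFI_interpretation => k.
(* Exceeding [k] gives lines with enough points for the game; exceeding 2 makes [p] odd, as the
   kernel computation requires. *)
have [p kp p_pr] := prime_above (maxn k 2).
have p_odd : odd p.
  by case: (even_prime p_pr) => // p2; move: kp; rewrite p2 ltnNge leq_maxr.
pose f : base_edge (biclique p) -> 'F_2 := fun=> 0.
(* A single twisted edge gives [g] total parity 1, against 0 for [f]. *)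
pose g : base_edge (biclique p) -> 'F_2 := fun e => (e == point 0 0)%:R.
have neq_fg : \sum_e f e <> \sum_e g e.
  rewrite big1 // (bigD1 (point 0 0)) //= big1 /g ?eqxx ?addr0 => [/eqP//|].
  by move=> e /negPf->.
pose S := CFI_expansion (@on_slanted p).
have asym h : asymmetric (S h).
  apply: system_asymmetric.
  - exact: expanded_le_total.
  - exact: edge_le_total.
  - exact: expanded_le_anti.
  - exact: edge_le_anti.
  - by move=> x; apply: plane_kernel.
exists (S f), (S g); split.
- by split; apply: CFI_expansion_total.
- by split; apply: asym.
- apply: system_Ck_equiv; apply: linear_space_free_variable => [c|].
    rewrite card_line card_Fp //; apply: ltnW; apply: leq_ltn_trans kp.
    exact: leq_maxl.
  exact: line_linear.
- by move/CFI_expansion_iso_parity.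
exists (biclique p), f, g; split; try exact: CFI_interpretation_iso.
move=> iso_im; apply/neq_fg/CFI_iso_parity.
apply: isomorphic_trans (CFI_interpretation_iso _ _).
exact: isomorphic_trans (isomorphic_sym (CFI_interpretation_iso _ _)) iso_im.
Qed.
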